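(* Let $\mathcal{Q}=\{\mathbf{q}_1<\mathbf{q}_2<\dots<\mathbf{q}_{|\mathcal{Q}|}\}$ be a finite totally ordered set, $\mathcal{S}$ a finite set, $P_{\mathbf{Q},S}$ a probability distribution on $\mathcal{Q}\times\mathcal{S}$ with all marginal probabilities $P_{\mathbf{Q}}(\mathbf{q})$ and $P_S(s)$ positive, $\ell\in\{1,\dots,|\mathcal{S}|\}$, and $p\in(0,p_\ell]$, where $p_\ell$ is the $\ell$-th largest value among $\{P_S(s):s\in\mathcal{S}\}$. Let $R$ be the number of equivalence classes returned by Greedy-Generalize (described in the context), and let $R'$ be the number of equivalence classes returned by any admissible, contiguous generalization algorithm. Then $R\ge R'$.
   Context: For $\overline{\mathbf{q}}\subseteq\mathcal{Q}$ let $P(\overline{\mathbf{q}},s)=\sum_{\mathbf{q}\in\overline{\mathbf{q}}}P_{\mathbf{Q},S}(\mathbf{q},s)$ and $S_{\overline{\mathbf{q}}}=\{s\in\mathcal{S}:P(\overline{\mathbf{q}},s)\ge p\}$. A generalization algorithm returns a partition of $\mathcal{Q}$ into nonempty equivalence classes. It is contiguous if every class is a set of consecutive elements $\{\mathbf{q}_a,\mathbf{q}_{a+1},\dots,\mathbf{q}_b\}$ in the total order, and admissible if every returned class $\overline{\mathbf{q}}$ satisfies $|S_{\overline{\mathbf{q}}}|\ge\ell$. Greedy-Generalize: process $\mathbf{q}_1,\mathbf{q}_2,\dots,\mathbf{q}_{|\mathcal{Q}|}$ in order, starting with an empty current class; add each quasi-identifier to the current class, and as soon as the current class $\overline{\mathbf{q}}$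 satisfies $|S_{\overline{\mathbf{q}}}|\ge\ell$, close it and start a new empty current class. When all quasi-identifiers have been processed, if the last current class is nonempty and not closed (so it has $|S_{\overline{\mathbf{q}}}|<\ell$), merge it into the last closed class. Return the closed classes; $R$ is their number. *)

(* Defs.v *)
From mathcomp Require Import all_boot all_order all_algebra.
From mathcomp Require Import reals.

Set Implicit Arguments.
Unset Strict Implicit.
Unset Printing Implicit Defensive.

Import Order.TTheory GRing.Theory Num.Theory.
Local Open Scope ring_scope.

Section Anonymization.
Variables (R : realType) (Q S : finType) (P : Q -> S -> R).

Definition is_joint_pmf : Prop :=
  (forall q s, 0 <= P q s) /\ \sum_q \sum_s P q s = 1.

Definition marginalQ (q : Q) : R := \sum_s P q s.
Definition marginalS (s : S) : R := \sum_q P q s.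

(* Values are counted with multiplicity, and [ell] starts at 1; the default 0
   is reached only when [ell] exceeds [#|S|]. *)
Definition nth_largest_marginalS (ell : nat) : R :=
  nth 0 (sort >=%R [seq marginalS s | s <- enum S]) ell.-1.

Definition class_prob (B : {set Q}) (s : S) : R := \sum_(q in B) P q s.

Definition sensitive_set (p : R) (B : {set Q}) : {set S} :=
  [set s | p <= class_prob B s].

Definition closable (ell : nat) (p : R) (B : {set Q}) : bool :=
  (ell <= #|sensitive_set p B|)%N.

(* [partition] forbids empty blocks. *)
Definition generalization (C : {set {set Q}}) : Prop := partition C [set: Q].

Definition admissible (ell : nat) (p : R) (C : {set {set Q}}) : Prop :=
  forall B, B \in C -> closable ell p B.

(* The scan returns the closed classes, most recently closed first, together
   with the class that is still open at the end. *)
Fixpoint greedy_scan (ell : nat) (p : R) (qs : seq Q)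
    (closed : seq {set Q}) (cur : {set Q}) : seq {set Q} * {set Q} :=
  if qs is q :: qs' then
    let cur' := q |: cur in
    if closable ell p cur' then greedy_scan ell p qs' (cur' :: closed) set0
    else greedy_scan ell p qs' closed cur'
  else (closed, cur).

(* A nonempty open class is dropped when there is no closed class to merge it
   into: it was never closed, and only closed classes are returned. *)
Definition merge_last (closed : seq {set Q}) (cur : {set Q}) : seq {set Q} :=
  if cur == set0 then closed
  else if closed is B :: closed' then (B :|: cur) :: closed' else [::].

End Anonymization.

Definition contiguous (d : Order.disp_t) (Q : finOrderType d)
    (C : {set {set Q}}) : Prop :=
  forall B, B \in C ->
    exists a b : Q, B = [set q | (a <= q)%O && (q <= b)%O].

(* [Order.enum Q] lists Q in increasing order. *)
Definition greedy_generalize (R : realType) (d : Order.disp_t)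
    (Q : finOrderType d) (S : finType) (P : Q -> S -> R) (ell : nat) (p : R) :
    {set {set Q}} :=
  let: (closed, cur) := greedy_scan P ell p (Order.enum Q) [::] set0 in
  [set:: merge_last closed cur].

(* Main.v *)
(* Every admissible interval [a, b] contains an element at which the greedy scan
   closes a class: otherwise the class open at b contains [a, b], hence is itself
   closable by monotonicity.  Disjoint intervals contain distinct closing
   elements, and there are as many closing elements as greedy classes. *)

Require Import Defs.
From mathcomp Require Import all_boot all_order all_algebra.
From mathcomp Require Import reals.

Local Open Scope ring_scope.

Import Order.TTheory GRing.Theory Num.Theory.

Section Closable.
Context {R : realType} {Q S : finType} {P : Q -> S -> R} {ell : nat} {p : R}.

(** Enlarging a class adds nonnegative terms to each [class_prob], so no value leaves the sensitive
    set. *)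
Lemma closableS (A B : {set Q}) :
  (forall q s, 0 <= P q s) -> A \subset B ->
  closable P ell p A -> closable P ell p B.
Proof.
move=> P_ge0 /subsetP sAB /leq_trans; apply; apply/subset_leq_card/subsetP => s.
rewrite !inE => /le_trans; apply; rewrite /class_prob.
rewrite [leRHS](big_setID A) /= (setIidPr _); last exact/subsetP.
by rewrite lerDl sumr_ge0.
Qed.

(** Ensures that a freshly started class is open, as the induction on the scan requires: its
    probabilities are all zero, hence below [p]. *)
Lemma closable0F : (0 < ell)%N -> 0 < p -> closable P ell p set0 = false.
Proof.
move=> ell_gt0 p_gt0; rewrite /closable.
suff -> : sensitive_set P p set0 = set0 by rewrite cards0 leqNgt ell_gt0.
by apply/setP => s; rewrite !inE /class_prob big_set0 leNgt p_gt0.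
Qed.

Definition disjoint_sets (A B : {set Q}) : bool := [disjoint A & B].

Lemma disjoint_setsUl (A B D : {set Q}) :
  disjoint_sets (A :|: B) D = disjoint_sets A D && disjoint_sets B D.
Proof. by rewrite /disjoint_sets -!setI_eq0 setIUl setU_eq0. Qed.

(** A repeated set would be disjoint from itself, hence empty. *)
Lemma pairwise_disjoint_uniq (Bs : seq {set Q}) :
  pairwise disjoint_sets Bs -> set0 \notin Bs -> uniq Bs.
Proof.
elim: Bs => //= B Bs IH /andP[/allP disjB pwBs]; rewrite inE negb_or.
case/andP=> B_neq0 Bs0; rewrite IH // andbT; apply/negP => /disjB.
by rewrite /disjoint_sets -setI_eq0 setIid eq_sym (negPf B_neq0).
Qed.

(** Needed because the output is a set of classes, where repetitions in the list would collapse. The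
    invariant includes freshness: an element still to be scanned lies in no class so far, so adding
    it to [cur] preserves disjointness. *)
Lemma greedy_scan_disjoint (qs : seq Q) (closed : seq {set Q}) (cur : {set Q}) :
  uniq qs -> {in qs, forall q, all (fun B : {set Q} => q \notin B) (cur :: closed)} ->
  pairwise disjoint_sets (cur :: closed) -> set0 \notin closed ->
  let: (closed', cur') := greedy_scan P ell p qs closed cur in
  pairwise disjoint_sets (cur' :: closed') /\ set0 \notin closed'.
Proof.
elim: qs closed cur => [|q qs IH] closed cur; first by [].
case/andP=> q_qs uniq_qs fresh pw nz.
have /andP[_ /allP q_closed] := fresh q (mem_head q qs).
have pw' : pairwise disjoint_sets ((q |: cur) :: closed).
  move: pw => /= /andP[/allP disj_cur ->]; rewrite andbT; apply/allP => B B_closed.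
  by rewrite disjoint_setsUl [disjoint_sets cur B]disj_cur // /disjoint_sets disjoints1 q_closed.
have fresh' : {in qs, forall x, all (fun B : {set Q} => x \notin B) ((q |: cur) :: closed)}.
  move=> x x_qs; have /andP[x_cur x_closed] := fresh x (mem_behead (s := q :: qs) x_qs).
  apply/andP; split=> //.
  by rewrite !inE (negPf x_cur) orbF; apply: contraNneq q_qs => <-.
rewrite /=; case: ifP => _; last exact: IH.
apply: IH => //.
- by move=> x x_qs; apply/andP; split; [rewrite inE | exact: fresh'].
- rewrite pairwise_cons pw' andbT; apply/allP => B _.
  by rewrite /disjoint_sets -setI_eq0 set0I.
- rewrite inE negb_or nz andbT eq_sym; apply/set0Pn; exists q; exact: setU11.
Qed.

(** Merging only enlarges the head of the list, by a set disjoint from the tail, so the classes stay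
    distinct. With no closed class both sides are zero. *)
Lemma card_merge_last (closed : seq {set Q}) (cur : {set Q}) :
  pairwise disjoint_sets (cur :: closed) -> set0 \notin closed ->
  #|[set:: merge_last closed cur]| = size closed.
Proof.
move=> pw nz; rewrite cardsE /merge_last; case: eqP => _.
  by apply/card_uniqP/pairwise_disjoint_uniq => //; case/andP: pw.
case: closed pw nz => [|B Bs]; first by rewrite card0.
rewrite /= inE negb_or => /andP[/andP[_ /allP cur_Bs] /andP[/allP B_Bs pw]].
case/andP=> B_neq0 nz; apply/card_uniqP/pairwise_disjoint_uniq.
  rewrite pairwise_cons pw andbT; apply/allP => A A_Bs.
  by rewrite disjoint_setsUl; apply/andP; split; [exact: B_Bs | exact: cur_Bs].
by rewrite inE negb_or nz andbT eq_sym setU_eq0 negb_and eq_sym B_neq0.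
Qed.

End Closable.

(** [E] collects the elements at which a class is closed. The last clause is the goal; the one
    before it strengthens the induction, covering intervals whose beginning has already been scanned
    into [cur]. *)
Lemma greedy_scan_closing_points {R : realType} {d : Order.disp_t}
    {Q : finOrderType d} {S : finType} {P : Q -> S -> R} {ell : nat} {p : R}
    (qs : seq Q) (closed : seq {set Q}) (cur : {set Q}) :
  (forall q s, 0 <= P q s) -> (0 < ell)%N -> 0 < p ->
  sorted <%O qs -> ~~ closable P ell p cur ->
  exists E : seq Q,
    [/\ size (greedy_scan P ell p qs closed cur).1 = (size E + size closed)%N,
        {subset E <= qs},
        forall b, closable P ell p (cur :|: [set q in qs | (q <= b)%O]) ->
          exists2 e, e \in E & (e <= b)%O
      & forall a b, closable P ell p [set q in qs | (a <= q <= b)%O] ->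
          exists2 e, e \in E & (a <= e <= b)%O].
Proof.
move=> P_ge0 ell_gt0 p_gt0.
elim: qs closed cur => [|q qs IH] closed cur sorted_qs cur_open.
  exists [::]; split=> // [b|a b].
    suff -> : [set x in [::] | (x <= b)%O] = set0 by rewrite setU0 (negPf cur_open).
    by apply/setP => x; rewrite !inE.
  suff -> : [set x in [::] | (a <= x <= b)%O] = set0 by rewrite closable0F.
  by apply/setP => x; rewrite !inE.
have /allP q_lt : all (> q)%O qs by exact: order_path_min lt_trans sorted_qs.
have {}sorted_qs := path_sorted sorted_qs.
have skip_q a b : (a <= q <= b)%O = false ->
    [set x in q :: qs | (a <= x <= b)%O] = [set x in qs | (a <= x <= b)%O].
  by move=> q_out; apply/setP => x; rewrite !inE; have [->|] := eqVneq x q; rewrite ?q_out ?andbF.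
rewrite /=; case: ifPn => [closes|q_cur_open].
  have [|E [sizeE subE _ hit]] := IH ((q |: cur) :: closed) set0 sorted_qs.
    by rewrite closable0F.
  exists (q :: E); split.
  - by rewrite sizeE /= addnS.
  - move=> x; rewrite !inE => /orP[->//|/subE ->]; exact: orbT.
  (* The closing point [q] itself serves every [b] above it. For [b] below [q] nothing is added to
     [cur], which is open by hypothesis. *)
  - move=> b; have [q_le_b _|b_lt_q] := leP q b; first by exists q; rewrite ?mem_head.
    suff -> : [set x in q :: qs | (x <= b)%O] = set0 by rewrite setU0 (negPf cur_open).
    apply/setP => x; rewrite !inE; apply/negP => /andP[/orP[/eqP->|/q_lt q_lt_x]].
      by rewrite leNgt b_lt_q.
    by rewrite leNgt (lt_trans b_lt_q).
  - move=> a b; case q_in: (a <= q <= b)%O; first by exists q; rewrite ?mem_head.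
    rewrite skip_q // => /hit[e eE e_in]; exists e => //.
    by rewrite inE eE orbT.
have [E [sizeE subE hit_cur hit]] := IH closed (q |: cur) sorted_qs q_cur_open.
exists E; split=> // [x /subE x_qs|b clos|a b].
- by rewrite inE x_qs orbT.
(* Here [q] merely moves from the remaining elements into the open class; if [b] is below [q] the
   set grows, which monotonicity allows. *)
- apply: hit_cur; apply: closableS clos => //; apply/subsetP => x.
  by rewrite !inE; case: (x == q); case: (x \in cur).
(* When the interval contains [q], its part in [q :: qs] lies in [q |: cur] together with the
   elements of [qs] up to [b]. The strengthened clause gives a closing point [e] at most [b]; as [e]
   comes from [qs], it exceeds [q] and hence [a]. *)
- case q_in: (a <= q <= b)%O; last by rewrite skip_q //; exact: hit.
  move=> clos; have [|e eE e_le_b] := hit_cur b.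
    apply: closableS clos => //; apply/subsetP => x.
    by rewrite !inE => /andP[/orP[->//|->] /andP[_ ->]]; rewrite orbT.
  exists e => //; rewrite e_le_b andbT; case/andP: q_in => /le_trans a_le_q _.
  by rewrite a_le_q // ltW // q_lt // subE.
Qed.

Theorem proposition4p6 (R : realType) (d : Order.disp_t) (Q : finOrderType d)
    (S : finType) (P : Q -> S -> R) (ell : nat) (p : R)
    (P_pmf : is_joint_pmf P)
    (PQ_gt0 : forall q : Q, 0 < marginalQ P q)
    (PS_gt0 : forall s : S, 0 < marginalS P s)
    (ell_range : (1 <= ell <= #|S|)%N)
    (p_range : 0 < p <= nth_largest_marginalS P ell)
    (C : {set {set Q}})
    (C_gen : generalization C)
    (C_contiguous : contiguous C)
    (C_admissible : admissible P ell p C) :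
  (#|C| <= #|greedy_generalize P ell p|)%N.
Proof.
have [P_ge0 _] := P_pmf.
have /andP[ell_gt0 _] := ell_range; have /andP[p_gt0 _] := p_range.
have Q_sorted : sorted <%O (Order.enum Q).
  by rewrite lt_sorted_uniq_le Order.enum_uniq sort_le_sorted.
have [|E [sizeE _ _ hit]] := greedy_scan_closing_points (Order.enum Q) [::] set0
  P_ge0 ell_gt0 p_gt0 Q_sorted _.
  by rewrite closable0F.
have := @greedy_scan_disjoint R Q S P ell p (Order.enum Q) [::] set0.
rewrite /greedy_generalize; case: greedy_scan sizeE => closed cur /= sizeE [] //.
- exact: Order.enum_uniq.
- by move=> q _; rewrite inE.
move=> pw nz; rewrite card_merge_last //.
have hit_class B : B \in C -> exists2 e, e \in E & e \in B.
  move=> BC; have [a [b defB]] := C_contiguous B BC.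
  have [|e eE e_in] := hit a b; last by exists e; rewrite // defB inE.
  suff -> : [set q in Order.enum Q | (a <= q <= b)%O] = B by exact: C_admissible.
  by rewrite defB; apply/setP => q; rewrite !inE Order.mem_enum.
case/and3P: C_gen => _ trivC _.
(* Blocks are disjoint, so a closing point determines the block containing it: [pblock C] maps [E]
   onto a family covering [C], which bounds the number of blocks by [size E]. *)
have sCE : C \subset [set pblock C e | e in E].
  apply/subsetP => B BC; have [e eE eB] := hit_class B BC.
  by rewrite -(def_pblock trivC BC eB) imset_f.
apply: leq_trans (subset_leq_card sCE) _.
by rewrite (leq_trans (leq_imset_card _ _)) // (leq_trans (card_size E)) // sizeE addn0.
Qed.
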